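(* As $n\to\infty$, $$f(n,4,3)\leq\frac{1}{200}n^{4}+O(n^{3}).$$ That is, there is a constant $C>0$ such that $f(n,4,3)\leq \frac{1}{200}n^{4}+Cn^{3}$ for all integers $n\geq 1$.
   Context: All graphs are finite and simple. For a graph $G$, $v(G)$ is its number of vertices, $\overline{G}$ is its complement, and $t_4(G)$ is the number of its $4$-cliques (sets of $4$ pairwise adjacent vertices). Define $$f(n,4,3)=\min\{t_4(G): v(G)=n,\ \overline{G}\text{ is triangle-free}\}.$$ *)

(* Defs.v *)
From HB Require Import structures.
From mathcomp Require Import all_boot.
Set Implicit Arguments.
Unset Strict Implicit.
Unset Printing Implicit Defensive.

Section Graphs.
Variable T : finType.
Implicit Types (E : {set T * T}) (A : {set T}).

Definition simple_edges E : bool :=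
  [forall x, (x, x) \notin E] &&
  [forall x, forall y, ((x, y) \in E) == ((y, x) \in E)].

(* Each edge {x, y} is represented by both ordered pairs, so that the simple
   graphs with vertex set T form a finite type. *)
Record sgraph := SGraph { edges : {set T * T}; _ : simple_edges edges }.

HB.instance Definition _ := [isSub for edges].
HB.instance Definition _ := [Finite of sgraph by <:].

Implicit Type G : sgraph.

Definition adj G : rel T := fun x y => (x, y) \in edges G.

Lemma adj_irrefl G : irreflexive (adj G).
Proof.
move=> x; case: G => E simpleE; case/andP: (simpleE) => irrE _.
exact/negbTE/(forallP irrE).
Qed.

Lemma adj_sym G : symmetric (adj G).
Proof.
move=> x y; case: G => E simpleE; case/andP: (simpleE) => _ symE.
exact/eqP/(forallP (forallP symE x)).
Qed.

Lemma sgraph_of_rel_subproof (e : rel T) :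
  simple_edges [set p | (p.1 != p.2) && (e p.1 p.2 || e p.2 p.1)].
Proof.
apply/andP; split; first by apply/forallP => x; rewrite inE eqxx.
apply/forallP => x; apply/forallP => y.
by rewrite !inE /= (eq_sym y x) (orbC (e y x)).
Qed.

(* The symmetric irreflexive closure makes this total in e. *)
Definition sgraph_of_rel (e : rel T) : sgraph := SGraph (sgraph_of_rel_subproof e).

Lemma adj_sgraph_of_rel (e : rel T) : irreflexive e -> symmetric e ->
  adj (sgraph_of_rel e) =2 e.
Proof.
move=> irre syme x y; rewrite /adj inE /= (syme y x) orbb.
by case: (eqVneq x y) => [->|_] //=; rewrite irre.
Qed.

Definition compl G : sgraph := sgraph_of_rel (fun x y => (x != y) && ~~ adj G x y).

Lemma adj_compl G x y : adj (compl G) x y = (x != y) && ~~ adj G x y.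
Proof.
rewrite adj_sgraph_of_rel // => [z | z t]; first by rewrite eqxx.
by rewrite eq_sym adj_sym.
Qed.

Definition clique G A : bool :=
  [forall x in A, forall y in A, (x != y) ==> adj G x y].

Definition kcliques k G : {set {set T}} :=
  [set A : {set T} | (#|A| == k) && clique G A].

Definition t4 G : nat := #|kcliques 4 G|.

Definition triangle_free G : bool := kcliques 3 G == set0.

Definition complete_graph : sgraph := sgraph_of_rel (fun x y => x != y).

Lemma complete_graphP : triangle_free (compl complete_graph).
Proof.
apply/eqP/setP => A; rewrite !inE; apply/negbTE/negP => /andP[/eqP A3 clA].
have /card_gt1P[x [y [xA yA xy]]] : 1 < #|A| by rewrite A3.
have := implyP (forall_inP (forall_inP clA x xA) y yA) xy.
rewrite adj_compl adj_sgraph_of_rel ?xy // => [z | z t]; first by rewrite eqxx.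
by rewrite eq_sym.
Qed.

End Graphs.

Section Transport.
Variables (S T : finType) (h : S -> T) (injh : injective h).
Implicit Types (H : sgraph S) (G : sgraph T).

Lemma kcliques_transport k H G :
  (forall x y, adj H x y = adj G (h x) (h y)) ->
  #|kcliques k H| <= #|kcliques k G|.
Proof.
move=> adjHG; rewrite -(card_imset _ (imset_inj injh)).
apply/subset_leq_card/subsetP => _ /imsetP[A AH ->].
move: AH; rewrite !inE card_imset // => /andP[-> /forall_inP clA] /=.
apply/forall_inP => _ /imsetP[x xA ->]; apply/forall_inP => _ /imsetP[y yA ->].
by rewrite (inj_eq injh) -adjHG; apply: (forall_inP (clA x xA)).
Qed.

Lemma induced_sgraph G : exists H, forall x y, adj H x y = adj G (h x) (h y).
Proof.
exists (sgraph_of_rel (fun x y => adj G (h x) (h y))) => x y.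
rewrite adj_sgraph_of_rel // => [z | z t]; first exact: adj_irrefl.
exact: adj_sym.
Qed.

End Transport.

(* f(n,4,3), as a minimum over the graphs with vertex set 'I_n. The default
   value satisfies the constraint by complete_graphP, so that the minimum is
   genuine; by f43P it is also the minimum over all graphs with n vertices. *)
Definition f43 (n : nat) : nat :=
  t4 [arg min_(G < complete_graph 'I_n | triangle_free (compl G)) t4 G].

Lemma f43P n :
  (exists G : sgraph 'I_n, triangle_free (compl G) /\ t4 G = f43 n) /\
  (forall (T : finType) (G : sgraph T),
     #|T| = n -> triangle_free (compl G) -> f43 n <= t4 G).
Proof.
rewrite /f43; case: arg_minnP => [|G0 tfG0 minG0]; first exact: complete_graphP.
split=> [|T G cardT tfG]; first by exists G0.
pose h (i : 'I_n) : T := enum_val (cast_ord (esym cardT) i).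
have injh : injective h by move=> i j /enum_val_inj /cast_ord_inj.
have [H adjH] := induced_sgraph h G.
apply: leq_trans (kcliques_transport injh 4 adjH); apply: minG0.
have := kcliques_transport (H := compl H) (G := compl G) injh 3.
rewrite (eqP tfG) cards0 leqn0 cards_eq0; apply=> x y.
by rewrite !adj_compl adjH (inj_eq injh).
Qed.

(* Main.v *)
Require Import Defs.
From mathcomp Require Import all_boot all_order all_algebra.
From mathcomp Require Import reals.
From mathcomp Require Import zify ring lra.
Import Order.TTheory GRing.Theory Num.Theory.
Local Open Scope ring_scope.

(** The extremal graph replaces the vertices of the 5-cycle by cliques [V_i] of
    equal size m and joins consecutive ones completely.  Among three colours two
    are equal or consecutive, so its complement is triangle-free.  A 4-clique
    lies in some [V_i :|: V_(i+1)], and choosing i to be a colour which occurs in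
    the clique excludes those contained in [V_(i+1)]; hence there are at most
    5 ('C(2m, 4) - 'C(m, 4)) <= 5 * 15 m^4 / 24 = (5m)^4 / 200 of them. *)

(** Restricting [H] to [n] of its vertices keeps the complement triangle-free and creates no
    4-clique. So blow-ups with all parts equal suffice even when 5 does not divide [n]. *)
Lemma f43_le_t4 (n : nat) (T : finType) (H : sgraph T) :
  (n <= #|T|)%N -> triangle_free (compl H) -> (f43 n <= t4 H)%N.
Proof.
move=> le_n_T tfH.
pose h (i : 'I_n) : T := enum_val (widen_ord le_n_T i).
have injh : injective h.
  by move=> i j /enum_val_inj /(congr1 val) /= /val_inj.
have [G adjG] := induced_sgraph h H.
apply: leq_trans (kcliques_transport injh 4 adjG).
apply: (proj2 (f43P n)); first exact: card_ord.
have := @kcliques_transport _ _ h injh 3 (compl G) (compl H).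
rewrite (eqP tfH) cards0 leqn0 cards_eq0; apply=> x y.
by rewrite !adj_compl adjG (inj_eq injh).
Qed.

Definition c5_near (a b : 'I_5) : bool := [|| a == b, b == ordS a | a == ordS b].

Lemma c5_near_sym : symmetric c5_near.
Proof. by move=> a b; rewrite /c5_near eq_sym [X in _ || X]orbC. Qed.

Lemma c5_near_triple (a b c : 'I_5) :
  [|| c5_near a b, c5_near b c | c5_near c a].
Proof.
by move: a b c; do 3![case=> [[|[|[|[|[|//]]]]] ?]].
Qed.

(** The last hypothesis leaves only [a = ordS b]; as the 5-cycle has no triangle, a colour near both
    ends of the edge from [b] to [a] is one of these ends. *)
Lemma c5_near_edge (a b c : 'I_5) : c5_near a b -> c5_near a c -> c5_near b c ->
  (b != a) && (b != ordS a) -> (c == b) || (c == ordS b).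
Proof.
by move: a b c; do 3![case=> [[|[|[|[|[|//]]]]] ?]].
Qed.

Definition c5_blowup (m : nat) : sgraph ('I_5 * 'I_m)%type :=
  sgraph_of_rel (fun x y => (x != y) && c5_near x.1 y.1).

Lemma adj_c5_blowup m x y :
  adj (c5_blowup m) x y = (x != y) && c5_near x.1 y.1.
Proof.
rewrite adj_sgraph_of_rel // => [z | z t]; first by rewrite eqxx.
by rewrite eq_sym c5_near_sym.
Qed.

Lemma triangle_free_compl_c5_blowup m : triangle_free (compl (c5_blowup m)).
Proof.
apply/eqP/setP => A; rewrite !inE; apply/negbTE/negP => /andP[/eqP A3 clA].
have /card_gt2P[x [y [z [[xA yA zA] [xy yz zx]]]]] : (2 < #|A|)%N by rewrite A3.
have far u v : u \in A -> v \in A -> u != v -> ~~ c5_near u.1 v.1.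
  move=> uA vA uv; have := implyP (forall_inP (forall_inP clA u uA) v vA) uv.
  by rewrite adj_compl adj_c5_blowup uv.
have := c5_near_triple x.1 y.1 z.1.
by rewrite (negbTE (far x y _ _ _)) // (negbTE (far y z _ _ _)) //
           (negbTE (far z x _ _ _)).
Qed.

Definition c5_part m (i : 'I_5) : {set 'I_5 * 'I_m} := setX [set i] setT.

Definition c5_parts2 m (i : 'I_5) : {set 'I_5 * 'I_m} :=
  setX [set i; ordS i] setT.

Lemma card_c5_part m i : #|c5_part m i| = m.
Proof. by rewrite cardsX cards1 cardsT card_ord mul1n. Qed.

Lemma card_c5_parts2 m i : #|c5_parts2 m i| = (2 * m)%N.
Proof.
by rewrite cardsX cards2 cardsT card_ord; case: i => [[|[|[|[|[|//]]]]] ?].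
Qed.

Lemma clique_c5_blowup m (A : {set 'I_5 * 'I_m}) :
    A != set0 -> clique (c5_blowup m) A ->
  exists i, (A \subset c5_parts2 m i) && ~~ (A \subset c5_part m (ordS i)).
Proof.
move=> /set0Pn[x xA] clA.
have near u v : u \in A -> v \in A -> c5_near u.1 v.1.
  move=> uA vA; have [->|uv] := eqVneq u v; first by rewrite /c5_near eqxx.
  have := implyP (forall_inP (forall_inP clA u uA) v vA) uv.
  by rewrite adj_c5_blowup uv.
have part u : u \in A -> ~~ (A \subset c5_part m (ordS u.1)).
  move=> uA; apply/subsetPn; exists u => //.
  by rewrite !inE andbT; case: u.1 => [[|[|[|[|[|//]]]]] ?].
(* Otherwise some [y] in [A] has the colour preceding [x.1], and the edge starting at [y.1] captures
   all of [A]. *)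
have [Ax|/subsetPn[y yA]] := boolP (A \subset c5_parts2 m x.1).
  by exists x.1; rewrite Ax part.
rewrite !inE andbT negb_or => yx; exists y.1; rewrite part // andbT.
apply/subsetP => z zA; rewrite !inE andbT.
by apply: c5_near_edge yx; apply: near.
Qed.

Lemma t4_c5_blowup m : (t4 (c5_blowup m) <= 5 * ('C(2 * m, 4) - 'C(m, 4)))%N.
Proof.
pose D (B : {set 'I_5 * 'I_m}) := [set A : {set _} | A \subset B & #|A| == 4].
pose W i := D (c5_parts2 m i) :\: D (c5_part m (ordS i)).
have cardW i : #|W i| = ('C(2 * m, 4) - 'C(m, 4))%N.
  rewrite cardsD (setIidPr _) ?cards_draws ?card_c5_part ?card_c5_parts2 //.
  apply/subsetP => A; rewrite !inE => /andP[/subset_trans-> //].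
  by apply/subsetP => x; rewrite !inE !andbT => ->; rewrite orbT.
have sub : kcliques 4 (c5_blowup m) \subset \bigcup_i W i.
  apply/subsetP => A; rewrite inE => /andP[A4 clA].
  have [|i /andP[Ai nAi]] := @clique_c5_blowup m A _ clA.
    by rewrite -card_gt0 (eqP A4).
  by apply/bigcupP; exists i => //; rewrite !inE (negbTE nAi) Ai.
apply: leq_trans (subset_leq_card sub) _.
apply: leq_trans (_ : \sum_i #|W i| <= _)%N; last first.
  by rewrite (eq_bigr _ (fun i _ => cardW i)) sum_nat_const card_ord.
elim/big_ind2: _ => [|k B l B' leB leB'|//]; first by rewrite cards0.
by apply: leq_trans (leq_card_setU _ _) _; apply: leq_add.
Qed.

Lemma leq_bin4_diff m : (24 * ('C(2 * m, 4) - 'C(m, 4)) <= 15 * m ^ 4)%N.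
Proof.
rewrite mulnBr ![(24 * _)%N]mulnC !(bin_ffact _ 4) leq_subLR.
(* For [m = k + 4] no factor of the falling factorials is truncated. *)
case: m => [|[|[|[|k]]]] //.
rewrite (_ : 2 * k.+4 = (2 * k + 4).+4)%N; last by lia.
rewrite !ffactnS !ffactn0 /=.
(* The added polynomial is the exact slack $42m^3 - 33m^2 + 6m$ at $m = k + 4$. *)
apply: leq_trans (leq_addr (42 * k ^ 3 + 471 * k ^ 2 + 1758 * k + 2184) _) _.
by apply/eq_leq; ring.
Qed.

Lemma t4_c5_blowup_leq m : (200 * t4 (c5_blowup m) <= (5 * m) ^ 4)%N.
Proof.
have := t4_c5_blowup m; have := leq_bin4_diff m; rewrite expnMn; lia.
Qed.

Theorem mainTheorem1 (R : realType) :
  exists C : R, 0 < C /\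
    forall n : nat, (1 <= n)%N ->
      (f43 n)%:R <= 1 / 200 * n%:R ^+ 4 + C * n%:R ^+ 3 :> R.
Proof.
(* The constant is 1400 / 200, from [le_n] below. *)
exists 7; split=> // n n_gt0.
(* This choice gives $n \leq 5m \leq n + 5$. *)
pose m := (n %/ 5).+1.
have le_f43 : (f43 n <= t4 (c5_blowup m))%N.
  apply: f43_le_t4 (triangle_free_compl_c5_blowup m).
  by rewrite card_prod !card_ord /m; lia.
have le_n : (200 * f43 n <= n ^ 4 + 1400 * n ^ 3)%N.
  apply: leq_trans (_ : (n + 5) ^ 4 <= _)%N; last first.
    (* As $n \geq 1$, each lower power is at most $n^3$, and 20 + 150 + 500 + 625 = 1295 is below
       1400. Writing [n ^ 1] and [n ^ 0] lets [pow] treat all terms alike. *)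
    have -> : ((n + 5) ^ 4 =
        n ^ 4 + 20 * n ^ 3 + 150 * n ^ 2 + 500 * n ^ 1 + 625 * n ^ 0)%N by ring.
    have pow k : (k <= 3)%N -> (n ^ k <= n ^ 3)%N by apply: leq_pexp2l.
    move: (pow 0 isT) (pow 1 isT) (pow 2 isT).
    move: (n ^ 0)%N (n ^ 1)%N (n ^ 2)%N (n ^ 3)%N (n ^ 4)%N; lia.
  apply: leq_trans (leq_trans _ (t4_c5_blowup_leq m)) _.
    by rewrite leq_mul2l le_f43.
  by rewrite leq_exp2r // /m; lia.
move: le_n; rewrite -(ler_nat R) natrD natrX (natrM R 200) (natrM R 1400) natrX; lra.
Qed.
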